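(* Let $k$ be a positive integer and let $\{a_i\}_{i\in\mathbb{N}}$ be a non-zero sequence of complex numbers with $a_{i+k}=a_i$ for all $i\in\mathbb{N}$. Let $$C_k=\prod_{i=0}^{k-1}A_{k-1-i}=A_{k-1}A_{k-2}\cdots A_1A_0,\qquad A_i=\begin{bmatrix} a_i & 1\\ 1& 0\end{bmatrix},$$ be the monodromy matrix. Then the Floquet multipliers of $C_k$, i.e. its eigenvalues, are $$\Phi_k^{\pm}=\frac12\left(T_k(1)\pm\sqrt{(T_k(1))^2-4(-1)^k}\right),$$ where $T_k(1)$ is the value at $t=1$ of $$T_k(t)=\Omega_k(t,\mathfrak{a}_{0,k-1})+\Omega_{k-2}(t,\mathfrak{a}_{1,k-2})\in\mathbb{C}[t],$$ with the formal polynomials $\Omega_m$ defined in the context.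
   Context: $\mathbb{N}=\{0,1,2,\ldots\}$. A ''non-zero sequence'' means a sequence that is not identically zero; individual terms may vanish. The square root of a complex number denotes one fixed choice of square root. For $i\le j$ write $\mathfrak{a}_{i,j}=(a_i,a_{i+1},\ldots,a_j)^T$, with $\mathfrak{a}_{i,i}=\mathfrak{a}_i=a_i$. Usual conventions on sums and products apply (empty product $=1$, empty sum $=0$). Let $n,p$ be positive integers of the same parity with $p\le n$. The symbol $\widehat{\sum}_{i_0,\ldots,i_{p-1}}^{n,p}$ denotes the $p$-fold nested sum over integers $i_0,\ldots,i_{p-1}$ with the following ranges: $0\le i_0\le \frac{n-p}{2}$; $i_{2m-1}+1\le i_{2m}\le \frac{n-p}{2}+m$ for each $m\ge 1$ with $2m\le p-1$; and $i_{2m}\le i_{2m+1}\le \frac{n-p}{2}+m$ for each $m\ge 0$ with $2m+1\le p-1$. (The upper bound of the innermost sum is $\frac{n-2}{2}$ if $n,p$ are even and $\frac{n-1}{2}$ if $n,p$ are odd.) For $L\in\mathbb{N}$, define the complex number $\chi_{n,p}(\mathfrak{a}_{L,L+n-1})$ as follows. If $n$ and $p$ are even, $0<p\le n$: $$\chi_{n,p}(\mathfrak{a}_{L,L+n-1})=\widehat{\sum_{i_0,\ldots,i_{p-1}}^{n,p}}\ \prod_{l=0}^{\frac p2-1}a_{L+2i_{2l}}\ \prod_{l=0}^{\frac p2-1}a_{L+1+2i_{2l+1}}.$$ For $n$ even and $p=0$, $\chi_{n,0}(v)=1$ for any vector $v$ (including $n=0$ with the empty vector). If $n$ and $p$ are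 odd, $1\le p\le n$: $$\chi_{n,p}(\mathfrak{a}_{L,L+n-1})=\widehat{\sum_{i_0,\ldots,i_{p-1}}^{n,p}}\ \prod_{l=0}^{\frac{p-1}2}a_{L+2i_{2l}}\ \prod_{l=0}^{\frac{p-1}2-1}a_{L+1+2i_{2l+1}}.$$ For $n\ge 0$ and $L\in\mathbb{N}$ define $$\Omega_n(t,\mathfrak{a}_{L,L+n-1})=\begin{cases}\displaystyle\sum_{j=0}^{n/2}\chi_{n,2j}(\mathfrak{a}_{L,L+n-1})\,t^{2j}, & n\text{ even},\\[2mm] \displaystyle\sum_{j=0}^{(n-1)/2}\chi_{n,2j+1}(\mathfrak{a}_{L,L+n-1})\,t^{2j+1}, & n\text{ odd}.\end{cases}$$ In particular $\Omega_0(t)=1$ (with the empty vector, e.g. $\mathfrak{a}_{1,0}$). For $k=1$ the term $\Omega_{-1}$ is an empty sum and equals $0$. *)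

(* Defs.v *)
From HB Require Import structures.
From mathcomp Require Import all_boot all_order all_algebra.
Set Implicit Arguments. Unset Strict Implicit. Unset Printing Implicit Defensive.
Import GRing.Theory.
Local Open Scope ring_scope.

Section Defs.
Variable C : comNzRingType.
Implicit Types (a : nat -> C) (L n p k : nat).

(* Sums over the remaining r indices i_j, ..., i_(j+r-1), the indices
   i_0, ..., i_(j-1) being already fixed as the entries of s. With j = 2m or
   j = 2m + 1, the upper bound of i_j is h + m, where h = (n - p) / 2. The
   lower bound is 0 for i_0, i_(j-1) for odd j, and i_(j-1) + 1 for even
   j > 0. *)
Fixpoint nested_sum (F : (nat -> nat) -> C) h r j (s : seq nat) : C :=
  if r is r'.+1 then
    \sum_((if j is j'.+1 then if odd j then nth 0%N s j' else (nth 0%N s j').+1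
           else 0%N) <= i < (h + j./2).+1)
      nested_sum F h r' j.+1 (rcons s i)
  else F (nth 0%N s).

Definition hat_sum n p (F : (nat -> nat) -> C) : C :=
  nested_sum F (n - p)./2 p 0 [::].

(* chi a L n p is chi_{n,p}(a_L, ..., a_(L+n-1)), meant for p <= n of the same
   parity. The numbers of factors are p/2 and p/2 for even p, (p+1)/2 and
   (p-1)/2 for odd p; for p = 0 the value is an empty product, i.e. 1. *)
Definition chi a L n p : C :=
  hat_sum n p (fun i : nat -> nat =>
    \prod_(0 <= l < uphalf p) a (L + 2 * i (2 * l))%N *
    \prod_(0 <= l < p./2) a (L + 1 + 2 * i (2 * l + 1))%N).

Definition Omega a L n : {poly C} :=
  if odd n then
    \sum_(0 <= j < (n.-1)./2.+1) chi a L n (2 * j + 1) *: 'X^(2 * j + 1)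
  else
    \sum_(0 <= j < n./2.+1) chi a L n (2 * j) *: 'X^(2 * j).

(* For k = 1 the second summand is Omega_{-1}, which is 0. *)
Definition Tpoly a k : {poly C} :=
  Omega a 0 k + (if (2 <= k)%N then Omega a 1 (k - 2) else 0).

Definition transfer_mx a (i : nat) : 'M[C]_2 :=
  \matrix_(r < 2, c < 2)
    nth 0 (nth [::] [:: [:: a i; 1]; [:: 1; 0]] r) c.

Definition monodromy a k : 'M[C]_2 :=
  \prod_(i < k) transfer_mx a (k - 1 - i).

End Defs.

(* Main.v *)
Require Import Defs.
From HB Require Import structures.
From mathcomp Require Import all_boot all_order all_algebra.
From mathcomp Require Import reals complex.
From mathcomp Require Import zify ring.
Set Implicit Arguments. Unset Strict Implicit. Unset Printing Implicit Defensive.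
Import Order.TTheory GRing.Theory Num.Theory.
Local Open Scope ring_scope.
Local Open Scope complex_scope.

(** Multiplication by a matrix A_L is one step of a three-term recurrence, so
the entries of A_(L+n) ... A_L are the continuants
K(a_L, ..., a_(L+n)), K(a_(L+1), ..., a_(L+n)), K(a_L, ..., a_(L+n-1)) and
K(a_(L+1), ..., a_(L+n-1)), where
K(a_L, ..., a_(L+n+1)) = a_L K(a_(L+1), ..., a_(L+n+1))
                         + K(a_(L+2), ..., a_(L+n+1)).
The trace of the monodromy matrix is therefore
K(a_0, ..., a_(k-1)) + K(a_1, ..., a_(k-2)), its determinant is (-1)^k, and
the multipliers come from the quadratic formula.

It remains to see that the value of Omega at 1 is a continuant
([Omega_at1_rec]). By Euler's rule the continuant of a word is the sum over
all ways of deleting disjoint pairs of adjacent letters, of the product of the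
letters that survive. When p letters survive out of n, the surviving positions
increase, their parities alternate starting with an even one, and
h = (n - p) / 2 pairs have been deleted. The position of the j-th survivor is
2 i_j for even j and 2 i_j + 1 for odd j, and the ranges of the nested sum say
exactly that an even number of letters is deleted before the first survivor,
between consecutive ones and after the last, 2 h in all. Reading the word from its first survivor makes the nested
sum a self-similar one, [survivor_sum] (lemma [chiE]), and deciding whether
the first letter survives gives its recurrence ([survivor_sumSS]), which sums
over h to that of the continuant. *)

(** * Nested sums as sums over deletions of adjacent pairs *)

Section Continuant.
Variable C : comNzRingType.
Implicit Types (a : nat -> C) (L n p h r j : nat) (s : seq nat).

(** The terms of Euler's rule for the word a_L, ..., a_(L+r+2h-1) in which h
adjacent pairs are deleted and r letters survive; d counts the pairs that lie
before the first survivor. *)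
Fixpoint survivor_sum a r h L : C :=
  if r is r'.+1 then
    \sum_(0 <= d < h.+1) a (L + 2 * d)%N * survivor_sum a r' (h - d) (L + 2 * d).+1
  else 1.

(** The lower bound of i_j in the nested sum, written so as to be convertible to
the expression there. *)
Definition next_bound j s : nat :=
  if j is j'.+1 then if odd j then nth 0%N s j' else (nth 0%N s j').+1 else 0%N.

Lemma next_bound_rcons j s i :
  size s = j -> next_bound j.+1 (rcons s i) = (i + odd j)%N.
Proof.
by move=> szs; rewrite /= nth_rcons szs ltnn eqxx; case: (odd j) => /=; lia.
Qed.

Lemma prod_even_odd (f : nat -> C) p :
  \prod_(0 <= l < uphalf p) f (2 * l)%N * \prod_(0 <= l < p./2) f (2 * l + 1)%N
  = \prod_(0 <= l < p) f l.
Proof.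
elim: p => [|p IHp]; first by rewrite !big_geq // mulr1.
rewrite [RHS]big_nat_recr //= -IHp uphalf_half.
case: (boolP (odd p)) => [p_odd | p_even].
  rewrite add1n [X in _ * X = _]big_nat_recr //= mulrA.
  by congr (_ * f _); lia.
rewrite add0n big_nat_recr //= mulrAC.
by congr (_ * f _); lia.
Qed.

(** The induction behind [chiE]: once i_0, ..., i_(j-1) are fixed, the survivors
chosen so far factor out, and the rest of the word starts at the least
position that i_j may denote, with as many pairs left to delete as i_j may
exceed its lower bound. The bound on [next_bound j s], which keeps the
subtraction from being truncated, passes from each index to the next. *)
Lemma nested_sumE a L h r j s :
  size s = j -> (next_bound j s <= h + j./2)%N ->
  nested_sum (fun i => \prod_(0 <= l < j + r) a (L + odd l + 2 * i l)%N) h r j s =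
  \prod_(0 <= l < j) a (L + odd l + 2 * nth 0%N s l)%N *
    survivor_sum a r (h + j./2 - next_bound j s) (L + odd j + 2 * next_bound j s).
Proof.
elim: r j s => [|r IHr] j s szs lb_le; first by rewrite /= addn0 mulr1.
rewrite [LHS]/= -/(next_bound j s) [survivor_sum _ _ _ _]/= big_distrr /=.
set b := next_bound j s in lb_le *.
rewrite -{1}[b]add0n big_addn -subSn; last exact: lb_le.
apply: eq_big_nat => d /andP[_ d_lt].
have szs' : size (rcons s (d + b)) = j.+1 by rewrite size_rcons szs.
have lb' := next_bound_rcons (d + b) szs.
rewrite addnS -addSn IHr //; last first.
  by rewrite lb' /= uphalf_half; lia.
rewrite lb' big_nat_recr //= nth_rcons szs ltnn eqxx -mulrA.
congr (_ * _).
  apply: eq_big_nat => l /andP[_ l_lt].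
  by rewrite nth_rcons szs l_lt.
congr (a _ * survivor_sum a r _ _); first by lia.
  by rewrite uphalf_half; lia.
by case: (odd j) => /=; lia.
Qed.

Lemma chiE a L n p : chi a L n p = survivor_sum a p (n - p)./2 L.
Proof.
transitivity (nested_sum
  (fun i => \prod_(0 <= l < 0 + p) a (L + odd l + 2 * i l)%N) (n - p)./2 p 0 [::]).
  have nested_ext F G h r j s : F =1 G ->
      @nested_sum C F h r j s = nested_sum G h r j s.
    move=> FG; elim: r j s => [|r IHr] j s /=; first exact: FG.
    by apply: eq_bigr => i _; exact: IHr.
  apply: nested_ext => i.
  rewrite -(prod_even_odd (fun l => a (L + odd l + 2 * i l)%N)).
  congr (_ * _); apply: eq_bigr => l _; congr (a _).
    by rewrite oddM addn0.
  by rewrite oddD oddM.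
rewrite nested_sumE //= big_geq // mul1r.
by congr (survivor_sum a p _ _); lia.
Qed.

(** * The continuant recurrence *)

Lemma survivor_sumS0 a r L :
  survivor_sum a r.+1 0 L = a L * survivor_sum a r 0 L.+1.
Proof. by rewrite /= big_nat1 muln0 addn0. Qed.

(** Either the first letter survives, or the first two are deleted together. *)
Lemma survivor_sumSS a r h L :
  survivor_sum a r.+1 h.+1 L =
  a L * survivor_sum a r h.+1 L.+1 + survivor_sum a r.+1 h L.+2.
Proof.
rewrite [LHS]/= big_nat_recl // muln0 addn0; congr (_ + _).
rewrite /=; apply: eq_bigr => d _.
by congr (a _ * survivor_sum a r _ _); lia.
Qed.

Lemma Omega_at1E a L n :
  (Omega a L n).[1] =
  \sum_(0 <= h < n./2.+1) survivor_sum a (n - 2 * h) h L.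
Proof.
rewrite [RHS]big_nat_rev /= add0n /Omega.
have [n_odd | n_even] := boolP (odd n).
  have -> : n.-1./2 = n./2 by lia.
  rewrite horner_sum; apply: eq_big_nat => j /andP[_ j_lt].
  rewrite hornerZ hornerXn expr1n mulr1 chiE.
  by congr (survivor_sum a _ _ L); lia.
rewrite horner_sum; apply: eq_big_nat => j /andP[_ j_lt].
rewrite hornerZ hornerXn expr1n mulr1 chiE.
by congr (survivor_sum a _ _ L); lia.
Qed.

Lemma Omega_at1_0 a L : (Omega a L 0).[1] = 1.
Proof. by rewrite Omega_at1E big_nat1. Qed.

Lemma Omega_at1_1 a L : (Omega a L 1).[1] = a L.
Proof. by rewrite Omega_at1E big_nat1 survivor_sumS0 /= mulr1. Qed.

(** The continuant recurrence: [survivor_sumSS] summed over the number h of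
deleted pairs. *)
Lemma Omega_at1_rec a L n :
  (Omega a L n.+2).[1] =
  a L * (Omega a L.+1 n.+1).[1] + (Omega a L.+2 n).[1].
Proof.
rewrite !Omega_at1E.
rewrite big_nat_recl // [in X in _ = a L * X + _]big_nat_recl //.
rewrite !muln0 !subn0 survivor_sumS0 mulrDr -addrA; congr (_ + _).
rewrite big_distrr /=.
have [n_odd | n_even] := boolP (odd n).
  have -> : uphalf n = n./2.+1 by lia.
  rewrite -big_split; apply: eq_big_nat => h /andP[_ h_lt] /=.
  have -> : (n.+2 - 2 * h.+1 = (n.+1 - 2 * h.+1).+1)%N by lia.
  rewrite survivor_sumSS; congr (_ + survivor_sum a _ _ _); lia.
(* For even n the last term deletes the whole word: no letter survives, and
   only the deletion of the first pair contributes. *)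
have -> : uphalf n = n./2 by lia.
rewrite big_nat_recr //= [in X in _ = _ + X]big_nat_recr //= addrA.
congr (_ + _); last first.
  have -> : (n.+2 - 2 * n./2.+1 = 0)%N by lia.
  by have -> : (n - 2 * n./2 = 0)%N by lia.
rewrite -big_split; apply: eq_big_nat => h /andP[_ h_lt] /=.
have -> : (n.+2 - 2 * h.+1 = (n.+1 - 2 * h.+1).+1)%N by lia.
rewrite survivor_sumSS; congr (_ + survivor_sum a _ _ _); lia.
Qed.

(** * The monodromy matrix *)

(** The continuant of length n - 1. The value 0 at length -1 makes the
recurrence hold from length 1 on, and agrees with Omega_(-1) = 0. *)
Definition Omega_pred_at1 a L n : C :=
  if n is n'.+1 then (Omega a L n').[1] else 0.

Definition transfer_prod a L n : 'M[C]_2 :=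
  \prod_(i < n) transfer_mx a (L + n - 1 - i).

Lemma transfer_prodS a L n :
  transfer_prod a L n.+1 = transfer_prod a L.+1 n *m transfer_mx a L.
Proof.
rewrite /transfer_prod big_ord_recr /=; congr (_ *m transfer_mx a _); last by lia.
by apply: eq_bigr => i _; congr (transfer_mx a _); lia.
Qed.

(** The induction adds a letter at the front, that is, a factor on the right; it
acts on each row separately, by the recurrence [Omega_at1_rec]. *)
Lemma transfer_prod_entries a L n :
  [/\ transfer_prod a L n.+1 0 0 = (Omega a L n.+1).[1],
      transfer_prod a L n.+1 0 1 = (Omega a L.+1 n).[1],
      transfer_prod a L n.+1 1 0 = (Omega a L n).[1] &
      transfer_prod a L n.+1 1 1 = Omega_pred_at1 a L.+1 n].
Proof.
elim: n L => [|n IHn] L.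
  rewrite transfer_prodS /transfer_prod big_ord0 mul1mx !mxE /=.
  by rewrite !Omega_at1_0 Omega_at1_1.
have [e00 e01 e10 e11] := IHn L.+1.
rewrite transfer_prodS !mxE !big_ord_recl !big_ord0 !mxE /= !addr0 !mulr1 !mulr0.
have -> : lift ord0 (ord0 : 'I_1) = 1 :> 'I_2 by exact: val_inj.
rewrite e00 e01 e10 e11 !addr0 Omega_at1_rec; split=> //.
  by rewrite mulrC.
case: n {IHn e00 e01 e10 e11} => [|n] /=.
  by rewrite Omega_at1_0 Omega_at1_1 mul1r addr0.
by rewrite Omega_at1_rec mulrC.
Qed.

Lemma det_mx22 (D : comNzRingType) (M : 'M[D]_2) :
  \det M = M 0 0 * M 1 1 - M 0 1 * M 1 0.
Proof.
have lift01 : lift ord0 (ord0 : 'I_1) = 1 :> 'I_2 by exact: val_inj.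
have lift10 : lift 1 (ord0 : 'I_1) = 0 :> 'I_2 by exact: val_inj.
rewrite (expand_det_row _ ord0) !big_ord_recl big_ord0 addr0 lift01.
rewrite /cofactor !det_mx11 !mxE lift01 lift10.
by rewrite expr0 expr1 mul1r mulN1r mulrN.
Qed.

Lemma det_transfer_mx a i : \det (transfer_mx a i) = -1.
Proof. by rewrite det_mx22 !mxE /= mulr0 mulr1 sub0r. Qed.

Lemma det_monodromy a k : \det (monodromy a k) = (-1) ^+ k.
Proof.
rewrite /monodromy (big_morph _ (@det_mulmx C 2) (det1 C 2)).
under eq_bigr do rewrite det_transfer_mx.
by rewrite prodr_const card_ord.
Qed.

Lemma trace_monodromy a k : (0 < k)%N -> \tr (monodromy a k) = (Tpoly a k).[1].
Proof.
case: k => // k _; rewrite -[monodromy a k.+1]/(transfer_prod a 0 k.+1).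
have [e00 _ _ e11] := transfer_prod_entries a 0 k.
rewrite /mxtrace !big_ord_recl big_ord0 addr0.
have -> : lift ord0 (ord0 : 'I_1) = 1 :> 'I_2 by exact: val_inj.
rewrite e00 e11 /Tpoly hornerD; congr (_ + _).
by case: k {e00 e11} => [|k] /=; rewrite ?horner0 // subSS subn1.
Qed.

Lemma char_poly_mx22_split (M : 'M[C]_2) (x y : C) :
  \tr M = x + y -> \det M = x * y ->
  char_poly M = ('X - x%:P) * ('X - y%:P).
Proof.
move=> trM detM.
have -> : char_poly M = 'X^2 - (\tr M)%:P * 'X + (\det M)%:P.
  rewrite /char_poly !det_mx22 !mxE /= /mxtrace !big_ord_recl big_ord0 addr0.
  have -> : lift ord0 (ord0 : 'I_1) = 1 :> 'I_2 by exact: val_inj.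
  rewrite !mulr1n !mulr0n !rmorphB !rmorphD !rmorphM /=.
  by ring.
by rewrite trM detM polyCD polyCM; ring.
Qed.

End Continuant.

Theorem proposition3p4 (R : realType) (sqrtc : R[i] -> R[i])
    (sqrtcP : forall z : R[i], sqrtc z ^+ 2 = z)
    (k : nat) (k_gt0 : (0 < k)%N)
    (a : nat -> R[i]) (a_nz : exists i : nat, a i != 0)
    (a_per : forall i : nat, a (i + k)%N = a i) :
  let T1 : R[i] := (Tpoly a k).[1] in
  let Phi_plus : R[i] :=
    1 / 2 * (T1 + sqrtc (T1 ^+ 2 - 4 * (-1) ^+ k)) in
  let Phi_minus : R[i] :=
    1 / 2 * (T1 - sqrtc (T1 ^+ 2 - 4 * (-1) ^+ k)) in
  (forall z : R[i],
     eigenvalue (monodromy a k) z <-> z = Phi_plus \/ z = Phi_minus) /\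
  char_poly (monodromy a k) = ('X - Phi_plus%:P) * ('X - Phi_minus%:P).
Proof.
move=> T1 Phi_plus Phi_minus.
have sum_Phi : Phi_plus + Phi_minus = T1.
  by rewrite /Phi_plus /Phi_minus; field.
have prod_Phi : Phi_plus * Phi_minus = (-1) ^+ k.
  rewrite /Phi_plus /Phi_minus; set d := T1 ^+ 2 - _.
  have -> : 1 / 2 * (T1 + sqrtc d) * (1 / 2 * (T1 - sqrtc d))
          = (T1 ^+ 2 - sqrtc d ^+ 2) / 4 by field.
  by rewrite sqrtcP /d; field.
have char_fact :
    char_poly (monodromy a k) = ('X - Phi_plus%:P) * ('X - Phi_minus%:P).
  by apply: char_poly_mx22_split; rewrite ?trace_monodromy ?det_monodromy.
split=> // z.
rewrite eigenvalue_root_char char_fact rootM !root_XsubC.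
by split=> [/orP[] /eqP-> | [] ->]; rewrite ?eqxx ?orbT; [left | right | |].
Qed.
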